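(* Let $d=2$ and let $\mathcal{V}=\begin{bmatrix} v^{1} & v^{2}\end{bmatrix}^{T}$ be a symmetric vector of functionals, associated with the monic $2$-symmetric sequence $\{S_n\}_{n\ge 0}$ of type II multiple orthogonal polynomials, and let $J$ be the Jacobi matrix of $\{S_n\}$, assumed to be a bounded operator. Put $v_{1,0}=v^{1}(S_0)=v^1(1)$ and $v_{2,1}=v^{2}(S_1)=v^2(x)$. Then the Weyl function of $J$ is given, for $|z|>\|J\|$, by $$\mathcal{R}_{J}(z)=\sum_{n=0}^{\infty }\frac{1}{z^{3n+1}}\begin{bmatrix}\frac{v^{1}(x^{3n})}{v_{1,0}} & 0 \\ 0 & \frac{v^{2}(x^{3n+1})}{v_{2,1}}\end{bmatrix}+\sum_{n=0}^{\infty }\frac{1}{z^{3n+2}}\begin{bmatrix}0 & \frac{v^{2}(x^{3n+1})}{v_{2,1}} \\ 0 & 0\end{bmatrix}+\sum_{n=0}^{\infty }\frac{1}{z^{3n+3}}\begin{bmatrix}0 & 0 \\ \frac{v^{1}(x^{3n+3})}{v_{1,0}} & 0\end{bmatrix}.$$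
   Context: $\mathbb{P}$ is the space of polynomials in $x$ with complex coefficients; functionals are linear maps $\mathbb{P}\to\mathbb{C}$; $\mathcal{M}_{2\times 2}$ is the set of complex $2\times 2$ matrices. A monic $2$-symmetric sequence of type II multiple orthogonal ($2$-orthogonal) polynomials $\{S_n\}_{n\ge0}$ is one satisfying $S_n(x)=x^n$ for $0\le n\le 2$ and $xS_{n+2}(x)=S_{n+3}(x)+\gamma_{n+1}S_n(x)$ for $n\ge 0$, with complex numbers $\gamma_{n+1}\neq 0$; equivalently, it is $2$-orthogonal and $S_n(\xi x)=\xi^nS_n(x)$ for every cube root of unity $\xi$. Write $\mathcal{S}_n=\begin{bmatrix}S_{2n} & S_{2n+1}\end{bmatrix}^T$. A vector of functionals $\mathcal{V}=\begin{bmatrix}v^1&v^2\end{bmatrix}^T$ acts on a column of two polynomials by $$\mathcal{V}\left(\begin{bmatrix}P_1 \\ P_2\end{bmatrix}\right)=\begin{bmatrix}v^1(P_1) & v^2(P_1) \\ v^1(P_2) & v^2(P_2)\end{bmatrix},$$ and $(x^k\mathcal{V})(\mathcal{P})=\mathcal{V}(x^k\mathcal{P})$. The vector $\mathcal{V}$ is called symmetric (associated with $\{S_n\}$) if $\{\mathcal{S}_n\}$ is a type II vector multiple orthogonal polynomial sequence with respect to $\mathcal{V}$, i.e. for every $n\ge 0$: $(x^k\mathcal{V})(\mathcal{S}_n)=0_{2\times2}$ for $k=0,\dots,n-1$, and $(x^n\mathcal{V})(\mathcal{S}_n)=\Delta_n$ with $\Delta_n$ an invertible upper triangular $2\times 2$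 matrix. The Jacobi matrix $J$ of $\{S_n\}$ is the semi-infinite matrix (rows and columns indexed by $0,1,2,\dots$) with $J_{k,k+1}=1$, $J_{k+2,k}=\gamma_{k+1}$ for $k\ge 0$, and all other entries zero, so that $x\,[S_0,S_1,\dots]^T=J\,[S_0,S_1,\dots]^T$. When $J$ is a bounded operator (on $\ell^2$), the Weyl function associated with $J$ is $$\mathcal{R}_J(z)=\sum_{n=0}^\infty \frac{\mathbf{e}_0^TJ^n\mathbf{e}_0}{z^{n+1}},\qquad |z|>\|J\|,$$ where $\mathbf{e}_0=\begin{bmatrix}I_2&0_{2\times2}&0_{2\times 2}&\cdots\end{bmatrix}^T$, so $\mathbf{e}_0^TJ^n\mathbf{e}_0$ is the upper-left $2\times2$ block of $J^n$. *)

(* Defs.v *)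
From HB Require Import structures.
From mathcomp Require Import all_boot all_order all_algebra.
From mathcomp Require Import all_classical all_reals all_analysis.
From mathcomp Require Import complex.

Set Implicit Arguments.
Unset Strict Implicit.
Unset Printing Implicit Defensive.

Import Order.TTheory GRing.Theory Num.Theory.
Import numFieldNormedType.Exports.

Local Open Scope classical_set_scope.
Local Open Scope ring_scope.

(* Complex modulus, with values in R. *)
Notation cmod := (@ComplexField.Normc.normc _).

Section Definitions.
Variable R : realType.
Local Notation C := R[i].

(* gamma 0 is irrelevant: the recurrence coefficients are gamma_1, gamma_2, ... *)
Definition two_symmetric (gamma : nat -> C) (S : nat -> {poly C}) : Prop :=
  [/\ forall n, (n <= 2)%N -> S n = 'X^n,
      forall n, 'X * S n.+2 = S n.+3 + gamma n.+1 *: S n &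
      forall n, gamma n.+1 != 0].

Definition pvec (S : nat -> {poly C}) (n : nat) : 'cV[{poly C}]_2 :=
  \col_(i < 2) S (2 * n + i)%N.

(* V i is the functional v^(i+1). *)
Definition vact (V : 'I_2 -> {scalar {poly C}}) (P : 'cV[{poly C}]_2) :
    'M[C]_2 :=
  \matrix_(i < 2, j < 2) V j (P i 0).

Definition vactX (k : nat) (V : 'I_2 -> {scalar {poly C}})
    (P : 'cV[{poly C}]_2) : 'M[C]_2 :=
  vact V ('X^k *: P).

(* is_trig_mx is lower triangularity, hence the transpose. *)
Definition symmetric_vector (S : nat -> {poly C})
    (V : 'I_2 -> {scalar {poly C}}) : Prop :=
  forall n,
    (forall k, (k < n)%N -> vactX k V (pvec S n) = 0) /\
    (is_trig_mx (vactX n V (pvec S n))^T /\ vactX n V (pvec S n) \in unitmx).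

(* The sums over [set: nat] below are finite-support sums (0 when the support
   is infinite): they are the matrix-vector and matrix-matrix products for
   matrices with finitely supported rows, such as the powers of a Jacobi
   matrix. *)
Definition smx_app (A : nat -> nat -> C) (u : nat -> C) : nat -> C :=
  fun k => \sum_(j \in [set: nat]) A k j * u j.

Definition smx_mul (A B : nat -> nat -> C) : nat -> nat -> C :=
  fun k l => \sum_(j \in [set: nat]) A k j * B j l.

Definition smx_exp (A : nat -> nat -> C) (n : nat) : nat -> nat -> C :=
  iter n (smx_mul A) (fun k l => (k == l)%:R).

Definition in_l2 (u : nat -> C) : Prop :=
  cvgn (series (fun k => cmod (u k) ^+ 2)).

Definition l2norm (u : nat -> C) : R :=
  Num.sqrt (limn (series (fun k => cmod (u k) ^+ 2))).

Definition l2_bounded (A : nat -> nat -> C) : Prop :=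
  exists M : R, forall u, in_l2 u ->
    in_l2 (smx_app A u) /\ l2norm (smx_app A u) <= M * l2norm u.

Definition opnorm (A : nat -> nat -> C) : R :=
  sup [set l2norm (smx_app A u) | u in [set u | in_l2 u /\ l2norm u <= 1]].

Definition jacobi (gamma : nat -> C) : nat -> nat -> C :=
  fun k j => if j == k.+1 then 1 else if k == j.+2 then gamma j.+1 else 0.

(* e_0^T A e_0 *)
Definition ul_block (A : nat -> nat -> C) : 'M[C]_2 :=
  \matrix_(i < 2, j < 2) A i j.

Definition mx2 (a b c d : C) : 'M[C]_2 :=
  \matrix_(i < 2, j < 2) nth 0 (nth [::] [:: [:: a; b]; [:: c; d]] i) j.

(* The topology on 2 x 2 complex matrices is found through the alias C^o,
   which carries the topology of the complex modulus. *)
Definition mx_summable (f : nat -> 'M[C]_2) : Prop :=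
  cvgn (series (f : nat -> 'M[C^o]_2)).

Definition mx_sum (f : nat -> 'M[C]_2) : 'M[C]_2 :=
  limn (series (f : nat -> 'M[C^o]_2)).

Definition weyl_term (A : nat -> nat -> C) (z : C) (n : nat) : 'M[C]_2 :=
  z ^- n.+1 *: ul_block (smx_exp A n).

(* Meaningful when weyl_term A z is summable. *)
Definition weyl (A : nat -> nat -> C) (z : C) : 'M[C]_2 :=
  mx_sum (weyl_term A z).

End Definitions.

(* Main.v *)
Require Import Defs.
From mathcomp Require Import all_boot all_order all_algebra.
From mathcomp Require Import all_classical all_reals all_analysis.
From mathcomp Require Import complex.
Import Order.TTheory GRing.Theory Num.Theory.
Import numFieldNormedType.Exports.
Local Open Scope ring_scope.

(** Orthogonality at [k = 0] says that [v^1] and [v^2] vanish on [S_m] for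
    [m >= 2] and that [v^1(S_1) = 0], so applying them to
    [x^n S_k = sum_j (J^n)_(k,j) S_j] expresses the moments through the entries
    [(J^n)_(k,0)] and [(J^n)_(k,1)].  Since [J] shifts indices by [1] modulo [3],
    [(J^n)_(k,j)] vanishes unless [k + n = j] modulo [3]; this isolates each
    entry (in particular it removes [v^2(S_0)], which may be nonzero) and splits
    the Weyl series according to [n] modulo [3].  All the series are dominated by
    a geometric one, because the [l]-th column of [J^n] is [J^n] applied to a
    unit vector of l2, hence has norm at most [opnorm J ^ n]. *)

Local Notation Re := complex.Re.
Local Notation Im := complex.Im.

(** * Elementary estimates for the complex modulus *)

Lemma cmod_ge0 (R : realType) (x : R[i]) : 0 <= cmod x.
Proof. by case: x => a b; rewrite sqrtr_ge0. Qed.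

Lemma cmodX (R : realType) (x : R[i]) n : cmod (x ^+ n) = cmod x ^+ n.
Proof.
elim: n => [|n IHn]; first by rewrite !expr0 ComplexField.Normc.normc1.
by rewrite !exprS ComplexField.Normc.normcM IHn.
Qed.

Lemma cmodR (R : realType) (x : R) : 0 <= x -> cmod (x%:C)%C = x.
Proof. by move=> x0; rewrite /= expr0n addr0 sqrtr_sqr ger0_norm. Qed.

Lemma normr_cmod (R : realType) (x : R[i]) : `|x| = (cmod x)%:C%C.
Proof. by []. Qed.


Lemma Re_le_cmod (R : realType) (x : R[i]) : `|Re x| <= cmod x.
Proof. by case: x => a b /=; rewrite -sqrtr_sqr ler_wsqrtr// lerDl sqr_ge0. Qed.

Lemma Im_le_cmod (R : realType) (x : R[i]) : `|Im x| <= cmod x.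
Proof. by case: x => a b /=; rewrite -sqrtr_sqr ler_wsqrtr// lerDr sqr_ge0. Qed.

Lemma cmod_le_ReIm (R : realType) (x : R[i]) : cmod x <= `|Re x| + `|Im x|.
Proof.
case: x => a b /=; rewrite -[leRHS]ger0_norm ?addr_ge0// -sqrtr_sqr ler_wsqrtr//.
by rewrite sqrrD !real_normK ?num_real// lerD2r lerDl mulrn_wge0// mulr_ge0.
Qed.

(** * Convergence of series of complex 2 x 2 matrices *)

Section Summability.
Variable R : realType.
Local Notation C := R[i].
Local Open Scope classical_set_scope.

Lemma Re_series (f : nat -> C) n : Re (series f n) = series (fun k => Re (f k)) n.
Proof. by rewrite /series/= raddf_sum. Qed.

Lemma Im_series (f : nat -> C) n : Im (series f n) = series (fun k => Im (f k)) n.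
Proof. by rewrite /series/= raddf_sum. Qed.

Lemma cvgn_series_dominated (f g : R^nat) :
  (forall n, `|f n| <= g n) -> cvgn (series g) -> cvgn (series f).
Proof.
move=> fg cg; apply: (@normed_cvg R R^o).
have g0 n : 0 <= g n by rewrite (le_trans _ (fg n)).
by apply: series_le_cvg cg => // n; rewrite normr_ge0.
Qed.

(* R[i] carries no complete uniform structure in the library, so the limit is
   assembled from the real and imaginary parts of the entries. *)
Lemma mx_summable_dominated (f : nat -> 'M[C]_2) (g : R^nat) :
  (forall n i j, cmod (f n i j) <= g n) -> cvgn (series g) -> mx_summable f.
Proof.
move=> fg cg.
pose a i j := limn (series (fun n => Re (f n i j))).
pose b i j := limn (series (fun n => Im (f n i j))).
have ca i j : series (fun n => Re (f n i j)) @ \oo --> a i j.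
  apply: cvgn_series_dominated cg => n; exact: le_trans (Re_le_cmod _ _) (fg n i j).
have cb i j : series (fun n => Im (f n i j)) @ \oo --> b i j.
  apply: cvgn_series_dominated cg => n; exact: le_trans (Im_le_cmod _ _) (fg n i j).
suff : series (f : nat -> 'M[C^o]_2) @ \oo -->
    (\matrix_(i, j) (a i j +i* b i j)%C : 'M[C^o]_2) by move/cvgP.
apply/cvg_ballP => eps eps0.
(* The radius [eps] is itself a complex number; its positivity forces it to be real. *)
have eE : eps = (Re eps)%:C%C.
  by move: eps0; case: eps => x y; rewrite ltcE/= => /andP[/eqP-> _].
have e0 : 0 < Re eps by move: eps0; rewrite {1}eE ltcR.
have e20 : 0 < Re eps / 2 by rewrite divr_gt0.
have Hn : \forall n \near \oo, forall i j,
    `|a i j - series (fun n => Re (f n i j)) n| < Re eps / 2 /\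
    `|b i j - series (fun n => Im (f n i j)) n| < Re eps / 2.
  apply: filter_forall => i; apply: filter_forall => j; apply: filterI.
  - by move/cvgrPdist_lt : (ca i j); apply.
  - by move/cvgrPdist_lt : (cb i j); apply.
near=> n; split=> // i j.
rewrite /ball/= mxE.
have [ha hb] : `|a i j - series (fun n => Re (f n i j)) n| < Re eps / 2 /\
    `|b i j - series (fun n => Im (f n i j)) n| < Re eps / 2.
  by move: i j; near: n.
have -> : (series (f : nat -> 'M[C^o]_2) n) i j = series (fun n => f n i j) n.
  by rewrite /series/= summxE.
rewrite [X in X < _]normr_cmod eE ltcR (le_lt_trans (cmod_le_ReIm _ _))//.
rewrite !raddfB/= Re_series Im_series (splitr (Re eps)).
exact: ltrD.
Unshelve. all: by end_near.
Qed.

(** The partial sums of [f] along multiples of 3 are the sums of the three partial series; being a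
    subsequence, they keep the limit of the full series, and limits are unique. *)
Lemma mx_sum_split3 (f : nat -> 'M[C]_2) :
  mx_summable f -> mx_summable (fun n => f (3 * n)%N) ->
  mx_summable (fun n => f (3 * n).+1) -> mx_summable (fun n => f (3 * n).+2) ->
  mx_sum f = mx_sum (fun n => f (3 * n)%N) + mx_sum (fun n => f (3 * n).+1)
             + mx_sum (fun n => f (3 * n).+2).
Proof.
move=> cf c0 c1 c2.
pose F n : 'M[C^o]_2 := series (f : nat -> 'M[C^o]_2) (3 * n)%N.
have cF : F @ \oo --> (mx_sum f : 'M[C^o]_2) by exact: cvg_comp (@cvg_mulnl 3 isT) cf.
suff : F @ \oo --> (mx_sum (fun n => f (3 * n)%N) + mx_sum (fun n => f (3 * n).+1)
    + mx_sum (fun n => f (3 * n).+2) : 'M[C^o]_2).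
  by apply: cvg_unique cF; exact: norm_hausdorff.
rewrite (_ : F = (fun n =>
    series ((fun n => f (3 * n)%N) : nat -> 'M[C^o]_2) n
  + series ((fun n => f (3 * n).+1) : nat -> 'M[C^o]_2) n
  + series ((fun n => f (3 * n).+2) : nat -> 'M[C^o]_2) n)).
  exact: cvgD (cvgD c0 c1) c2.
apply/funext; rewrite /F; elim=> [|n IHn].
  by rewrite /series/= muln0 !big_geq// !addr0.
rewrite mulnS -[(3 + _)%N]/((3 * n).+3) !seriesSr {}IHn.
by rewrite [in RHS](addrACA _ (f (3 * n)%N)) [RHS]addrACA !addrA.
Qed.

End Summability.

(** * The l2 norm and the growth of powers of a bounded matrix *)

Section OperatorNorm.
Variable R : realType.
Local Notation C := R[i].
Local Open Scope classical_set_scope.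

Implicit Types (u : nat -> C) (A : nat -> nat -> C).

Lemma l2norm_ge0 u : 0 <= l2norm u.
Proof. exact: sqrtr_ge0. Qed.

Lemma cmod_le_l2norm u k : in_l2 u -> cmod (u k) <= l2norm u.
Proof.
move=> u2; rewrite -[leLHS]ger0_norm ?cmod_ge0// -sqrtr_sqr ler_wsqrtr//.
have nd : nondecreasing_seq (series (fun k => cmod (u k) ^+ 2)).
  by apply: nondecreasing_series => n _ _; exact: sqr_ge0.
apply: le_trans (nondecreasing_cvgn_le nd u2 k.+1).
by rewrite seriesSr lerDr; apply: sumr_ge0 => n _; exact: sqr_ge0.
Qed.

Lemma series_cmod2Z (c : C) u :
  series (fun k => cmod (c * u k) ^+ 2)
    = series (cmod c ^+ 2 *: ((fun k => cmod (u k) ^+ 2) : nat -> R^o)).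
Proof.
by congr series; apply/funext => k; rewrite ComplexField.Normc.normcM exprMn.
Qed.

Lemma in_l2Z (c : C) u : in_l2 u -> in_l2 (fun k => c * u k).
Proof. by move=> u2; rewrite /in_l2 series_cmod2Z; exact: is_cvg_seriesZ. Qed.

Lemma l2normZ (c : C) u : in_l2 u ->
  l2norm (fun k => c * u k) = cmod c * l2norm u.
Proof.
move=> u2; rewrite /l2norm series_cmod2Z lim_seriesZ// sqrtrM ?sqr_ge0//.
by rewrite sqrtr_sqr ger0_norm// cmod_ge0.
Qed.

Lemma series_delta l n :
  series (fun k => cmod ((k == l)%:R : C) ^+ 2) n = (l < n)%:R.
Proof.
elim: n => [|n IHn]; first by rewrite /series/= big_geq.
rewrite seriesSr IHn [in RHS]ltnS [in RHS]leq_eqVlt (eq_sym l).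
case: eqVneq => [->|_].
  by rewrite ltnn add0r mulr1n ComplexField.Normc.normc1 expr1n.
by rewrite mulr0n ComplexField.Normc.normc0 expr0n addr0.
Qed.

(** Unit vectors thus lie in l2 with norm 1, which starts the induction on the columns of the
    powers. *)
Lemma cvg_series_delta l :
  series (fun k => cmod ((k == l)%:R : C) ^+ 2) @ \oo --> (1 : R).
Proof.
apply: cvg_near_cst; near=> n; rewrite series_delta.
suff -> : (l < n)%N by [].
by near: n; exact: nbhs_infty_gt.
Unshelve. all: by end_near. Qed.

Section Bounded.
Variable A : nat -> nat -> C.
Hypothesis bA : l2_bounded A.
Hypothesis AZ : forall c u k,
  smx_app A (fun j => c * u j) k = c * smx_app A u k.

Lemma opnorm_ubound u : in_l2 u -> l2norm u <= 1 ->
  l2norm (smx_app A u) <= opnorm A.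
Proof.
move=> u2 u1; apply: ub_le_sup; last by exists u.
(* A [sup] bounds its set only if the set is bounded above; [M] comes without a sign, hence the
   absolute value. *)
have [M hM] := bA; exists `|M| => _ [w [w2 w1] <-].
rewrite (le_trans (hM _ w2).2)// (le_trans (ler_norm _))// normrM.
by rewrite ler_piMr// ger0_norm// l2norm_ge0.
Qed.

Lemma opnorm_ge0 : 0 <= opnorm A.
Proof.
(* The zero vector, taken as 0 times a unit vector, is the test vector in the unit ball. *)
have z0 : (fun k : nat => 0 * (k == 0%N)%:R : C) = (fun=> 0).
  by apply/funext => k; rewrite mul0r.
have d2 := cvgP _ (cvg_series_delta 0).
have z2 : in_l2 (fun=> 0 : C) by rewrite -z0; exact: in_l2Z d2.
have z1 : l2norm (fun=> 0 : C) <= 1.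
  by rewrite -z0 l2normZ// ComplexField.Normc.normc0 mul0r ler01.
exact: le_trans (l2norm_ge0 _) (opnorm_ubound _ z2 z1).
Qed.

Lemma l2norm_smx_app u : in_l2 u ->
  l2norm (smx_app A u) <= opnorm A * l2norm u.
Proof.
move=> u2; have [M hM] := bA.
(* A vector of norm 0 cannot be rescaled to norm 1, so there the bound by [M] is used directly. *)
have [u0|u0] := eqVneq (l2norm u) 0.
  by have := (hM _ u2).2; rewrite u0 !mulr0.
have up : 0 < l2norm u by rewrite lt_neqAle eq_sym u0 l2norm_ge0.
pose c : C := ((l2norm u)^-1%:C)%C.
have cc : cmod c = (l2norm u)^-1 by rewrite cmodR// invr_ge0 l2norm_ge0.
have := opnorm_ubound _ (in_l2Z c _ u2).
rewrite l2normZ// cc mulVf// => /(_ (lexx _)).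
rewrite (_ : smx_app A _ = (fun k => c * smx_app A u k)); last first.
  by apply/funext => k; rewrite AZ.
by rewrite l2normZ ?cc; [rewrite ler_pdivrMl// mulrC|exact: (hM _ u2).1].
Qed.

Lemma smx_exp_col n l :
  in_l2 (fun k => smx_exp A n k l) /\
  l2norm (fun k => smx_exp A n k l) <= opnorm A ^+ n.
Proof.
elim: n => [|n [IH2 IHn]].
  have cd := cvg_series_delta l; split; first exact: cvgP cd.
  by rewrite /l2norm (cvg_lim _ cd)// sqrtr1.
(* Since [smx_exp] multiplies by [A] on the left, the new column is by definition [smx_app A] of the
   old one. *)
have [M hM] := bA; split; first exact: (hM _ IH2).1.
rewrite exprS (le_trans (l2norm_smx_app _ IH2))//.
by rewrite ler_wpM2l// opnorm_ge0.
Qed.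

Lemma cmod_smx_exp n k l : cmod (smx_exp A n k l) <= opnorm A ^+ n.
Proof.
have [h2 hn] := smx_exp_col n l.
exact: le_trans (cmod_le_l2norm _ k h2) hn.
Qed.

Lemma cmod_weyl_term z n i j : cmod (weyl_term A z n i j)
  <= (cmod z)^-1 * (opnorm A / cmod z) ^+ n.
Proof.
rewrite !mxE ComplexField.Normc.normcM ComplexField.Normc.normcV cmodX.
rewrite exprS invfM -mulrA ler_wpM2l ?invr_ge0 ?cmod_ge0//.
rewrite expr_div_n mulrC ler_wpM2r ?invr_ge0 ?exprn_ge0 ?cmod_ge0//.
exact: cmod_smx_exp.
Qed.

(** The map [h] serves for the full series and for its three subseries: as the ratio
    [opnorm A / cmod z] is below 1, [n <= h n] lets one geometric series dominate them all. *)
Lemma mx_summable_weyl_term z (h : nat -> nat) : opnorm A < cmod z ->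
  (forall n, n <= h n)%N -> mx_summable (fun n => weyl_term A z (h n)).
Proof.
move=> Az hn; have z0 : 0 < cmod z := le_lt_trans opnorm_ge0 Az.
have q0 : 0 <= opnorm A / cmod z by rewrite divr_ge0 ?opnorm_ge0 ?cmod_ge0.
have q1 : opnorm A / cmod z < 1 by rewrite ltr_pdivrMr// mul1r.
apply: (@mx_summable_dominated _ _ (geometric (cmod z)^-1 (opnorm A / cmod z))).
  move=> n i j; apply: le_trans (cmod_weyl_term _ _ _ _) _ => /=.
  by rewrite ler_wpM2l ?invr_ge0 ?cmod_ge0// ler_wiXn2l// ltW.
by apply: is_cvg_geometric_series; rewrite ger0_norm.
Qed.

End Bounded.
End OperatorNorm.

Lemma ul_blockE (R : realType) (A : nat -> nat -> R[i]) :
  ul_block A = mx2 (A 0 0)%N (A 0 1)%N (A 1 0)%N (A 1 1)%N.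
Proof. by apply/matrixP => -[[|[|//]] ?] [[|[|//]] ?]; rewrite !mxE. Qed.

(** * Powers of the Jacobi matrix and moments *)

Section Jacobi.
Variables (R : realType) (gamma : nat -> R[i]).
Local Notation J := (jacobi gamma).
Local Open Scope classical_set_scope.

Lemma smx_app_jacobi u k : smx_app J u k
  = u k.+1 + (if k is k'.+2 then gamma k'.+1 * u k' else 0).
Proof.
(* For [k < 2] the truncated [k.-2] is 0, and the entry of [J] in that column is zero. *)
rewrite /smx_app (fsbigE [:: k.+1; k.-2]) => [|||j _] /=.
- rewrite !big_cons big_nil !in_setT addr0 /jacobi eqxx mul1r; congr (_ + _).
  case: k => [|[|k]] //=; rewrite ?mul0r//.
  by rewrite eqxx ifN// neq_ltn ltnS leqW.
- by rewrite inE andbT; case: k => [|[|k]] //=; rewrite neq_ltn !ltnS leqW ?orbT.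
- by [].
- rewrite !inE /jacobi => /norP[/negPf-> hj]; rewrite ifN ?mul0r//.
  by apply: contra hj => /eqP ->.
Qed.

Lemma smx_appZ_jacobi c u k :
  smx_app J (fun j => c * u j) k = c * smx_app J u k.
Proof.
by rewrite !smx_app_jacobi mulrDr; case: k => [|[|k]]; rewrite ?mulr0// mulrCA.
Qed.

Lemma smx_expS_jacobi n k l : smx_exp J n.+1 k l
  = smx_exp J n k.+1 l
    + (if k is k'.+2 then gamma k'.+1 * smx_exp J n k' l else 0).
Proof. exact: smx_app_jacobi. Qed.

(** Row [k] of [J] is supported in columns [k + 1] and [k - 2], which are congruent modulo 3. *)
Lemma smx_exp_jacobi_eq0 n k l :
  ((k + n) %% 3 != l %% 3)%N -> smx_exp J n k l = 0.
Proof.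
elim: n k => [|n IHn] k kl.
  rewrite /smx_exp/=; have [kl'|//] := eqVneq k l.
  by rewrite kl' addn0 eqxx in kl.
rewrite smx_expS_jacobi IHn ?addSnnS// add0r.
case: k kl => [|[|k]] // kl; rewrite IHn ?mulr0//.
by apply: contra kl; rewrite !addSn addnS -[(k + n).+3]addn3 modnDr.
Qed.

Lemma functional_smx_exp (S : nat -> {poly R[i]}) (v : {scalar {poly R[i]}}) n k :
  two_symmetric gamma S -> (forall m, v (S m.+2) = 0) ->
  v ('X^n * S k) = smx_exp J n k 0%N * v (S 0%N) + smx_exp J n k 1%N * v (S 1%N).
Proof.
move=> [S0 Srec _] vS; elim: n k => [|n IHn] k.
  rewrite expr0 mul1r /smx_exp/=; case: k => [|[|k]] /=.
  - by rewrite mul1r mul0r addr0.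
  - by rewrite mul1r mul0r add0r.
  - by rewrite vS !mul0r addr0.
(* One factor ['X] is absorbed into [S k] by the recurrence, which is row [k] of [J]; rows 0 and 1
   have no [gamma] term and use that the first polynomials are monomials. *)
rewrite exprSr -mulrA !smx_expS_jacobi; case: k => [|[|k]].
- have -> : 'X * S 0%N = S 1%N by rewrite !S0// mulr1.
  by rewrite !addr0.
- have -> : 'X * S 1%N = S 2%N by rewrite !S0.
  by rewrite !addr0.
rewrite Srec mulrDr linearD -scalerAr linearZ/= !IHn !mulrDl mulrDr !mulrA.
by rewrite addrACA.
Qed.

End Jacobi.

(** * The Weyl function in terms of the moments *)

Theorem theorem2 (R : realType) (gamma : nat -> R[i])
    (S : nat -> {poly R[i]}) (V : 'I_2 -> {scalar {poly R[i]}})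
    (hS : two_symmetric gamma S) (hV : symmetric_vector S V)
    (hJ : l2_bounded (jacobi gamma))
    (z : R[i]) (hz : opnorm (jacobi gamma) < cmod z) :
  let v1 := V 0 in
  let v2 := V 1 in
  let v10 := v1 (S 0%N) in
  let v21 := v2 (S 1%N) in
  let T1 := fun n : nat => z ^- (3 * n + 1) *:
    mx2 (v1 'X^(3 * n) / v10) 0
        0 (v2 'X^(3 * n + 1) / v21) in
  let T2 := fun n : nat => z ^- (3 * n + 2) *:
    mx2 0 (v2 'X^(3 * n + 1) / v21)
        0 0 in
  let T3 := fun n : nat => z ^- (3 * n + 3) *:
    mx2 0 0
        (v1 'X^(3 * n + 3) / v10) 0 in
  [/\ mx_summable (weyl_term (jacobi gamma) z),
      mx_summable T1, mx_summable T2, mx_summable T3 &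
      weyl (jacobi gamma) z = mx_sum T1 + mx_sum T2 + mx_sum T3].
Proof.
move=> v1 v2 v10 v21 T1 T2 T3.
pose J := jacobi gamma.
(* The polynomial of index [m.+2] sits in block [m.+2./2], at position [odd m]; this block has
   positive index, so orthogonality at power 0 applies. *)
have vS j m : V j (S m.+2) = 0.
  have [+ _] := hV m.+2./2; move/(_ 0%N isT)/matrixP.
  move/(_ (inord (odd m)) j).
  rewrite /vactX expr0 scale1r !mxE inordK; last by case: odd.
  suff <- : m.+2 = (2 * m.+2./2 + odd m)%N by [].
  by rewrite -[in LHS](odd_double_half m.+2) /= negbK addnC mul2n.
(* The block of index 0 yields the normalization: triangularity kills [v1 (S 1)], and the
   determinant, the product of the diagonal, makes [v10] and [v21] nonzero. *)
have [_ [trig un]] := hV 0%N; have /is_trig_mxP tr := trig.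
have v11 : v1 (S 1%N) = 0.
  by have := tr 0 1 isT; rewrite /vactX expr0 scale1r !mxE.
move: un; rewrite -unitmx_tr unitmxE unitfE det_trig// big_ord_recl big_ord1.
rewrite /vactX expr0 scale1r !mxE mulf_eq0 negb_or => /andP[v10n0].
rewrite (_ : lift ord0 ord0 = 1); last exact: val_inj.
move=> v21n0.
have mom1 n k : v1 ('X^n * S k) / v10 = smx_exp J n k 0%N.
  by rewrite (functional_smx_exp _ gamma _ _ _ _ hS (vS 0)) v11 mulr0 addr0 mulfK.
(* The congruence condition removes the term in [v2 (S 0)]; [mom1] needs none because [v1 (S 1)] is
   zero. *)
have mom2 n k : ((k + n) %% 3 != 0)%N ->
    v2 ('X^n * S k) / v21 = smx_exp J n k 1%N.
  move=> kn; rewrite (functional_smx_exp _ gamma _ _ _ _ hS (vS 1)) smx_exp_jacobi_eq0 ?mod0n//.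
  by rewrite mul0r add0r mulfK.
have [S0 _ _] := hS.
have m1 n : v1 'X^n / v10 = smx_exp J n 0%N 0%N.
  by rewrite -mom1 S0// mulr1.
(* Row 1 raises the degree by one, as [S 1] is ['X]; hence the moment of order 3n+3 comes from the
   power 3n+2 of [J]. *)
have m1' n : v1 'X^(n.+1) / v10 = smx_exp J n 1%N 0%N.
  by rewrite -mom1 S0// -exprSr.
have m2 n : (n %% 3 != 0)%N -> v2 'X^n / v21 = smx_exp J n 0%N 1%N.
  by move=> n0; rewrite -mom2// S0// mulr1.
have m2' n : (n.+1 %% 3 != 0)%N -> v2 'X^(n.+1) / v21 = smx_exp J n 1%N 1%N.
  by move=> n0; rewrite -mom2// S0// -exprSr.
have E1 : T1 = fun n => weyl_term J z (3 * n)%N.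
  apply/funext => n; rewrite /T1 /weyl_term addn1; congr (_ *: _).
  rewrite ul_blockE; congr mx2.
  - exact: m1.
  - by rewrite smx_exp_jacobi_eq0// add0n modnMr.
  - by rewrite smx_exp_jacobi_eq0// addnC mulnC modnMDl.
  - by rewrite m2'// -addn1 mulnC modnMDl.
have E2 : T2 = fun n => weyl_term J z (3 * n).+1.
  apply/funext => n; rewrite /T2 /weyl_term addn2 addn1; congr (_ *: _).
  rewrite ul_blockE; congr mx2.
  - by rewrite smx_exp_jacobi_eq0// add0n -addn1 mulnC modnMDl.
  - by rewrite m2// -addn1 mulnC modnMDl.
  - by rewrite smx_exp_jacobi_eq0// add1n -addn2 mulnC modnMDl.
  - by rewrite smx_exp_jacobi_eq0// add1n -addn2 mulnC modnMDl.
have E3 : T3 = fun n => weyl_term J z (3 * n).+2.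
  apply/funext => n; rewrite /T3 /weyl_term addn3; congr (_ *: _).
  rewrite ul_blockE; congr mx2.
  - by rewrite smx_exp_jacobi_eq0// add0n -addn2 mulnC modnMDl.
  - by rewrite smx_exp_jacobi_eq0// add0n -addn2 mulnC modnMDl.
  - exact: m1'.
  - by rewrite smx_exp_jacobi_eq0// add1n -addn3 mulnC modnMDl.
have sT h : (forall n, n <= h n)%N -> mx_summable (fun n => weyl_term J z (h n)).
  by apply: mx_summable_weyl_term => //; exact: smx_appZ_jacobi.
have s0 : mx_summable (weyl_term J z) by exact: sT.
have s1 : mx_summable T1 by rewrite E1; apply: sT => n; rewrite leq_pmull.
have s2 : mx_summable T2 by rewrite E2; apply: sT => n; rewrite leqW// leq_pmull.
have s3 : mx_summable T3 by rewrite E3; apply: sT => n; rewrite !leqW// leq_pmull.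
split; [exact: s0|exact: s1|exact: s2|exact: s3|].
rewrite E1 E2 E3 in s1 s2 s3 *.
exact: (mx_sum_split3 _ (weyl_term J z)).
Qed.
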